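(* There exists an absolute constant $C>0$ such that for all integers $d\ge 1$ and $\Delta\ge 2$, every $d$-degenerate graph $G$ of maximum degree $\Delta$ satisfies $\chi'_{\mathrm{inj}}(G)\le C\, d^3\log \Delta$. (That is, $\chi'_{\mathrm{inj}}(G)=O(d^3\log\Delta)$.)
   Context: All graphs are finite and simple. An injective edge-coloring of a graph $G$ is a function $\psi:E(G)\to\mathbb N$ such that whenever $\psi(e)=\psi(e')$ for distinct edges $e,e'$, no third edge of $G$ (distinct from $e$ and $e'$) joins an endpoint of $e$ to an endpoint of $e'$. The injective chromatic index $\chi'_{\mathrm{inj}}(G)$ is the minimum $k$ such that $G$ has an injective edge-coloring with colors in $\{1,\dots,k\}$. A graph is $d$-degenerate if every subgraph has a vertex of degree at most $d$. $\log$ denotes the natural logarithm. *)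

(* Defs.v *)
From HB Require Import structures.
From mathcomp Require Import all_boot.

Set Implicit Arguments.
Unset Strict Implicit.
Unset Printing Implicit Defensive.

Record sgraph := SGraph {
  vertex :> finType;
  adj : rel vertex;
  adj_sym : symmetric adj;
  adj_irrefl : irreflexive adj
}.

Definition edges (G : sgraph) : {set {set G}} :=
  [set [set u.1; u.2] | u : G * G & adj u.1 u.2].

Definition edge (G : sgraph) := {f : {set G} | f \in edges G}.

Definition degree (T : finType) (r : rel T) (x : T) : nat := #|[set y | r x y]|.

Definition max_degree (G : sgraph) : nat := \max_(x : G) degree (@adj G) x.

(* (S, r) is the subgraph with vertex set S and adjacency r; it need not be
   induced. *)
Definition subgraph (G : sgraph) (S : {set G}) (r : rel G) : Prop :=
  symmetric r /\
  forall x y : G, r x y -> [/\ x \in S, y \in S & adj x y].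

(* "Every subgraph" means every subgraph with at least one vertex. *)
Definition degenerate (d : nat) (G : sgraph) : Prop :=
  forall (S : {set G}) (r : rel G), subgraph S r -> S != set0 ->
    exists2 x : G, x \in S & degree r x <= d.

(* The edges f and f' may share an endpoint. *)
Definition joins (G : sgraph) (g f f' : edge G) : bool :=
  [exists x in val f, exists y in val f', val g == [set x; y]].

Definition injective_edge_coloring (G : sgraph) (psi : edge G -> nat) : bool :=
  [forall f : edge G, forall f' : edge G,
     (f != f') && (psi f == psi f') ==>
     ~~ [exists g : edge G, [&& g != f, g != f' & joins g f f']]].

(* An element i of 'I_k stands for the color i.+1, so that the colors are
   1, ..., k. *)
Definition inj_colorable (G : sgraph) (k : nat) : bool :=
  [exists psi : {ffun edge G -> 'I_k},
     injective_edge_coloring (fun f => (psi f).+1)].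

Lemma inj_colorable_ex (G : sgraph) : exists k, inj_colorable G k.
Proof.
exists #|{: edge G}|; apply/existsP; exists [ffun f => enum_rank f].
apply/forallP=> f; apply/forallP=> f'; apply/implyP=> /andP[/negP neq_ff'].
by rewrite !ffunE eqSS => /eqP/val_inj/enum_rank_inj/eqP.
Qed.

Definition inj_chromatic_index (G : sgraph) : nat :=
  ex_minn (inj_colorable_ex G).

(* Main.v *)
(** Idea. Order the vertices so that each has at most [d] earlier neighbours,
    its parents, and orient edges towards parents. Two vertices are related
    when they are adjacent or have a common child; this relation has degree at
    most [Delta * d.+1], so the vertices can be properly labelled with
    polynomially many labels in [Delta]. A [2d]-cover-free family indexed by
    the labels lives on a ground set of size [O(d^2 log Delta)], and gives each
    edge [u -> v] a point owned by [v] but by no other parent of [u] and by no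
    parent of [v]. Edges leaving a common tail thus receive distinct points,
    so a greedy choice of one more component, out of [2d + 1] values, separates
    [u -> v] from the edges that have the same point and whose tail is a parent
    of [u] or of [v]. *)

Require Import Defs.
From HB Require Import structures.
From mathcomp Require Import all_boot all_order all_algebra.
From mathcomp Require Import reals exp.
From mathcomp Require Import zify ring lra.

Set Implicit Arguments.
Unset Strict Implicit.
Unset Printing Implicit Defensive.
Import Order.TTheory GRing.Theory Num.Theory.
Local Open Scope ring_scope.

(** * Greedy colouring along a rank function *)

(** Colours are chosen rank by rank, all vertices of one rank at once. Ties in [rho] are allowed and
    impose no constraint, so edges can be ranked by their tails. *)
Lemma greedy_coloring (V : finType) (r : rel V) (rho : V -> nat) (n : nat) :
  (forall x, #|[set y | r x y & (rho y < rho x)%N]| < n)%N ->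
  exists c : V -> 'I_n,
    forall x y, r x y -> (rho y < rho x)%N -> c x != c y.
Proof.
move=> small.
have ex_color x (c : V -> 'I_n) :
    exists i, i \notin [set c y | y in [set y | r x y & (rho y < rho x)%N]].
  apply/existsP; rewrite -negb_forall; apply/negP => /forallP all_in.
  have := leq_imset_card c [set y | r x y & (rho y < rho x)%N].
  rewrite leqNgt => /negP; apply; apply: leq_trans (small x) _.
  by rewrite -[X in (X <= _)%N]card_ord; apply/subset_leq_card/subsetP.
suff [c cP] : exists c : V -> 'I_n, forall x y,
    (rho x < (\max_x rho x).+1)%N -> r x y -> (rho y < rho x)%N -> c x != c y.
  by exists c => x y; apply: cP; rewrite ltnS (leq_bigmax x).
elim: _.+1 => [|k [c cP]].
  have n_gt0 (x : V) : (0 < n)%N by exact: leq_ltn_trans (small x).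
  by exists (fun x => Ordinal (n_gt0 x)).
have [new newP] := fin_all_exists (fun x => ex_color x c).
exists (fun x => if rho x == k then new x else c x) => x y.
rewrite ltnS leq_eqVlt => /orP[/eqP xk|xk] rxy yx.
  have := newP x; rewrite xk eqxx -xk (ltn_eqF yx); apply: contraNneq => ->.
  by apply: imset_f; rewrite inE rxy.
by rewrite (ltn_eqF xk) (ltn_eqF (ltn_trans yx xk)) cP.
Qed.

(** * Cover-free families by counting functions *)

(** Overwriting the value of [f] at [v] is injective in the pair of the new value and [f], because
    the lost [f v] is still visible as [f w]. *)
Lemma card_ffun_eq2 (I : finType) (m : nat) (v w : I) : v != w ->
  (m * #|[set f : {ffun I -> 'I_m} | f v == f w]| <= #|{ffun I -> 'I_m}|)%N.
Proof.
move=> neq_vw; set A := [set f | _].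
pose upd (p : 'I_m * {ffun I -> 'I_m}) := [ffun x => if x == v then p.1 else p.2 x].
have upd_inj : {in setX [set: 'I_m] A &, injective upd}.
  move=> [a f] [b g]; rewrite !inE /= => /eqP fvw /eqP gvw /ffunP eq_upd.
  have eqw : f w = g w by have := eq_upd w; rewrite !ffunE eq_sym (negPf neq_vw).
  have := eq_upd v; rewrite !ffunE eqxx /= => ->; congr pair.
  apply/ffunP=> x; have := eq_upd x; rewrite !ffunE /=.
  by case: eqP => // -> _; rewrite fvw gvw.
by rewrite -[m in (m * _)%N]card_ord -cardsT -cardsX -(card_in_imset upd_inj) max_card.
Qed.

Lemma card_bigcup_le (I T : finType) (A : {set I}) (B : I -> {set T}) :
  (#|\bigcup_(i in A) B i| <= \sum_(i in A) #|B i|)%N.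
Proof.
elim/big_ind2: _ => [|A1 n1 A2 n2 le1 le2|//]; first by rewrite cards0.
by apply: leq_trans (leq_card_setU _ _) (leq_add le1 le2).
Qed.

(** Union bound: a random [f] has [f v = f w] with probability at most 1/m for each [w] in [S]. *)
Lemma card_ffun_covered (I : finType) (m : nat) (v : I) (S : {set I}) :
  (0 < m)%N -> v \notin S -> (2 * #|S| <= m)%N ->
  (2 * #|[set f : {ffun I -> 'I_m} | f v \in f @: S]| <= #|{ffun I -> 'I_m}|)%N.
Proof.
move=> m_gt0 vS Sm; rewrite -(leq_pmul2l m_gt0).
pose B w := [set f : {ffun I -> 'I_m} | f v == f w].
have sub : [set f : {ffun I -> 'I_m} | f v \in f @: S] \subset \bigcup_(w in S) B w.
  apply/subsetP=> f; rewrite inE => /imsetP[w wS fvw].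
  by apply/bigcupP; exists w => //; rewrite inE fvw.
have sum_le : (m * \sum_(w in S) #|B w| <= #|S| * #|{ffun I -> 'I_m}|)%N.
  rewrite big_distrr -sum_nat_const; apply: leq_sum => w wS.
  by apply: card_ffun_eq2; apply: contraNneq vS => ->.
have := leq_trans (subset_leq_card sub) (card_bigcup_le S B).
by move: sum_le Sm; nia.
Qed.

(** Averaging by double counting: each pair is covered by at most half of all functions, so some
    function covers at most half of the pairs. *)
Lemma uncover_half (I : finType) (m : nat) (X : {set I * {set I}}) :
  (0 < m)%N ->
  (forall p, p \in X -> p.1 \notin p.2 /\ (2 * #|p.2| <= m)%N) ->
  exists f : {ffun I -> 'I_m},
    (2 * #|[set p in X | f p.1 \in f @: p.2]| <= #|X|)%N.
Proof.
move=> m_gt0 Xgood; apply/existsP; apply: contraT; rewrite negb_exists.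
move=> /forallP bad; pose F := {ffun I -> 'I_m}.
have F_gt0 : (0 < #|{: F}|)%N by rewrite card_ffun card_ord expn_gt0 m_gt0.
have lt_sum : (#|{: F}| * #|X| <
    2 * \sum_(f : F) #|[set p in X | f p.1 \in f @: p.2]|)%N.
  rewrite big_distrr /= -sum_nat_const.
  have /card_gt0P[f0 _] := F_gt0.
  rewrite (bigD1 f0) //= [ltnRHS](bigD1 f0) //= -addSn; apply: leq_add.
    by rewrite ltnNge bad.
  by apply: leq_sum => f _; apply: ltnW; rewrite ltnNge bad.
have swap : (\sum_(f : F) #|[set p in X | f p.1 \in f @: p.2]| =
    \sum_(p in X) #|[set f : F | f p.1 \in f @: p.2]|)%N.
  rewrite (eq_bigr (fun f : F => \sum_(p in X | f p.1 \in f @: p.2) 1)%N); last first.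
    by move=> f _; rewrite sum1dep_card.
  rewrite (exchange_big_dep (mem X)) /=; last by move=> f p _ /andP[].
  by apply: eq_bigr => p pX; rewrite sum1dep_card; apply: eq_card => f; rewrite !inE pX.
suff : (2 * \sum_(p in X) #|[set f : F | f p.1 \in f @: p.2]| <= #|{: F}| * #|X|)%N.
  by rewrite -swap leqNgt lt_sum.
rewrite big_distrr mulnC -sum_nat_const; apply: leq_sum => p /Xgood[vS Sm].
exact: card_ffun_covered.
Qed.

(** Each coordinate at least halves the set of pairs still covered, so none is left after [t]
    rounds. *)
Lemma separating_tuple (I : finType) (m t : nat) (X : {set I * {set I}}) :
  (0 < m)%N ->
  (forall p, p \in X -> p.1 \notin p.2 /\ (2 * #|p.2| <= m)%N) ->
  (#|X| < 2 ^ t)%N ->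
  exists F : t.-tuple {ffun I -> 'I_m},
    forall p, p \in X -> has (fun f : {ffun I -> 'I_m} => f p.1 \notin f @: p.2) F.
Proof.
move=> m_gt0; elim: t X => [|t IHt] X Xgood.
  by rewrite ltnS leqn0 cards_eq0 => /eqP->; exists [tuple] => p; rewrite inE.
rewrite expnS => X_lt; have [f f_half] := uncover_half m_gt0 Xgood.
have [||F FP] := IHt [set p in X | f p.1 \in f @: p.2].
- by move=> p; rewrite inE => /andP[/Xgood].
- by rewrite -(ltn_pmul2l (isT : 0 < 2)%N) (leq_ltn_trans f_half).
exists [tuple of f :: F] => p pX /=; have [fp|//] := boolP (f p.1 \in _).
by apply: FP; rewrite inE pX.
Qed.

(* A pair [(v, S)] is listed as [v :: enum S], padded with copies of [v]. *)
Lemma card_pointed_sets (I : finType) (n : nat) :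
  (#|[set p : I * {set I} | p.1 \notin p.2 & #|p.2| <= n]| <= #|I| ^ n.+1)%N.
Proof.
pose unlist (g : {ffun 'I_n.+1 -> I}) := (g ord0, [set g i | i : 'I_n.+1] :\ g ord0).
rewrite -[n.+1 in leqRHS]card_ord -card_ffun.
apply: leq_trans (leq_imset_card unlist predT); apply/subset_leq_card/subsetP.
move=> [v S]; rewrite inE /= => /andP[vS Sn].
apply/imsetP; exists [ffun i : 'I_n.+1 => nth v (v :: enum S) i] => //.
rewrite /unlist ffunE /=; congr pair; apply/setP=> x; rewrite !inE.
have [->|neq_xv] /= := eqVneq x v; first exact: negPf.
apply/idP/imsetP=> [xS|[i _]]; last first.
  rewrite ffunE => def_x; rewrite -mem_enum.
  have [lt_i|le_i] := ltnP i (size (v :: enum S)); last first.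
    by rewrite def_x nth_default ?eqxx in neq_xv.
  have := mem_nth v lt_i; rewrite -def_x inE (negPf neq_xv) //.
have lt_x : ((index x (enum S)).+1 < n.+1)%N.
  by rewrite ltnS (leq_trans _ Sn) // cardE index_mem mem_enum.
by exists (Ordinal lt_x) => //; rewrite ffunE /= nth_index ?mem_enum.
Qed.

(** The ground set is ['I_t * 'I_m], and [v] owns the points [(j, F j v)]; no [n] other elements own
    all the points of [v]. *)
Lemma cover_free (I : finType) (m n t : nat) :
  (0 < m)%N -> (2 * n <= m)%N -> (#|I| ^ n.+1 < 2 ^ t)%N ->
  exists F : 'I_t -> I -> 'I_m, forall (v : I) (S : {set I}),
    v \notin S -> (#|S| <= n)%N ->
    exists j, forall w, w \in S -> F j w != F j v.
Proof.
move=> m_gt0 nm It.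
pose X := [set p : I * {set I} | p.1 \notin p.2 & (#|p.2| <= n)%N].
have [||F FP] := @separating_tuple I m t X m_gt0.
- move=> p; rewrite inE => /andP[? pn]; split=> //.
  by apply: leq_trans nm; rewrite leq_mul2l.
- exact: leq_ltn_trans (card_pointed_sets _ _) It.
exists (fun j => tnth F j) => v S vS Sn.
have /FP/hasP[_ /tnthP[j ->] /= fvS] : (v, S) \in X by rewrite inE /= vS.
by exists j => w wS; apply: contraNneq fvS => <-; apply: imset_f.
Qed.

(** * Degeneracy orders and injective edge-colorings *)

Lemma degenerate_order (d : nat) (G : sgraph) : degenerate d G ->
  exists2 pos : G -> nat, injective pos &
    forall x, (#|[set y | adj x y & (pos y < pos x)%N]| <= d)%N.
Proof.
move=> deg.
suff [pos [pos_inj _ pos_d]] : exists pos : G -> nat,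
    [/\ {in [set: G] &, injective pos},
        {in [set: G], forall x, (pos x < #|[set: G]|)%N}
      & {in [set: G], forall x,
          #|[set y in [set: G] | adj x y & (pos y < pos x)%N]| <= d}%N].
  exists pos => [x y|x]; first by apply: pos_inj; rewrite inE.
  by have := pos_d x (in_setT x); under eq_finset do rewrite in_setT.
move: [set: G] => S; have [n] := ubnP #|S|.
elim: n S => // n IHn S Sn.
have [->|Sn0] := eqVneq S set0.
  by exists (fun=> 0%N); split=> x; rewrite inE.
pose r := [rel x y : G | [&& x \in S, y \in S & adj x y]].
have [|x xS x_d] := deg S r _ Sn0.
  by split=> [y z|y z /and3P[]//]; rewrite /= adj_sym andbCA.
have cardS := cardsD1 x S; rewrite xS add1n in cardS.
have [|pos [pos_inj pos_lt pos_d]] := IHn (S :\ x); first by lia.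
(* The vertex [x] of small degree goes last: its position exceeds all those given by induction,
   which lie below [#|S :\ x|]. *)
exists (fun y => if y == x then #|S :\ x| else pos y); split.
- move=> y z yS zS; have [->|yx] := eqVneq y x; have [->|zx] := eqVneq z x => //.
  + by move=> eq_z; have := pos_lt z; rewrite !inE zx zS -eq_z ltnn => /(_ isT).
  + by move=> eq_y; have := pos_lt y; rewrite !inE yx yS -eq_y ltnn => /(_ isT).
  + by apply: pos_inj; rewrite !inE ?yx ?zx.
- move=> y yS; rewrite cardS ltnS; case: eqVneq => // yx.
  by apply/ltnW/pos_lt; rewrite !inE yx.
move=> y yS; case: (eqVneq y x) => [->|yx].
  apply: leq_trans x_d; apply/subset_leq_card/subsetP=> z.
  by rewrite !inE => /and3P[zS xz _]; rewrite /= xS zS.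
have yS' : y \in S :\ x by rewrite !inE yx.
apply: leq_trans (pos_d y yS'); apply/subset_leq_card/subsetP=> z.
rewrite !inE => /and3P[-> ->]; case: eqVneq => //= _.
by move/(ltn_trans (pos_lt y yS')); rewrite ltnn.
Qed.

Lemma degree_le_max (G : sgraph) (x : G) : (degree (@adj G) x <= max_degree G)%N.
Proof. exact: (leq_bigmax x). Qed.

(** This caps the number of parents by the maximum degree, so that the number of labels is
    polynomial in the maximum degree alone. *)
Lemma degenerate_minn (d : nat) (G : sgraph) :
  degenerate d G -> degenerate (minn d (max_degree G)) G.
Proof.
move=> deg S r sub Sn0; have [x xS xd] := deg S r sub Sn0.
exists x => //; rewrite leq_min xd (leq_trans _ (degree_le_max x)) //.
apply/subset_leq_card/subsetP=> y; rewrite !inE.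
by case: sub => _ /[apply] -[].
Qed.

Lemma inj_chromatic_index_le (G : sgraph) (T : finType) (psi : edge G -> T) :
  (forall e e' : edge G, e != e' -> psi e = psi e' ->
     forall g : edge G, g != e -> g != e' -> ~~ joins g e e') ->
  (inj_chromatic_index G <= #|T|)%N.
Proof.
move=> psiP; rewrite /inj_chromatic_index; case: ex_minnP => k _; apply.
apply/existsP; exists [ffun e => enum_rank (psi e)].
apply/forallP=> e; apply/forallP=> e'; apply/implyP=> /andP[neq].
rewrite !ffunE eqSS => /eqP/val_inj/enum_rank_inj eq_psi.
rewrite negb_exists; apply/forallP=> g.
by apply/negP=> /and3P[ge ge']; apply/negP/(psiP _ _ neq).
Qed.

Lemma edge_adj (G : sgraph) (e : edge G) (x y : G) : val e = [set x; y] -> adj x y.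
Proof.
move=> def_e; case/imsetP: (valP e) => -[u v] /=; rewrite inE def_e /= => uv eq_xy.
have neq_uv : u != v by apply: contraTneq uv => ->; rewrite adj_irrefl.
have := set21 x y; have := set22 x y; rewrite eq_xy => y_uv x_uv.
have := set21 u v; have := set22 u v; rewrite -eq_xy.
case/set2P: x_uv => ->; case/set2P: y_uv => -> //; last 1 first.
- by move=> _ /set2P[]eq_uv; rewrite eq_uv eqxx in neq_uv.
- by move=> /set2P[]eq_vu; rewrite eq_vu eqxx in neq_uv.
by rewrite adj_sym.
Qed.

(** * The coloring built from the parent sets *)

Section Coloring.

Variables (G : sgraph) (d : nat) (pos : G -> nat).
Hypothesis pos_inj : injective pos.

Let parents x := [set y : G | adj x y & (pos y < pos x)%N].
Hypothesis parents_le : forall x, (#|parents x| <= d)%N.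

Let related x y :=
  (x != y) && (adj x y || [exists u, (x \in parents u) && (y \in parents u)]).

Lemma card_related x :
  (#|[set y | related x y]| <= max_degree G * d.+1)%N.
Proof.
pose N := [set y : G | adj x y].
have sub : [set y | related x y] \subset \bigcup_(u in N) (u |: parents u).
  apply/subsetP=> y; rewrite inE => /andP[_ /orP[xy|/existsP[u]]].
    by apply/bigcupP; exists y; rewrite ?setU11 ?inE.
  rewrite [x \in _]inE => /andP[/andP[ux _] yu].
  by apply/bigcupP; exists u; rewrite ?setU1r // inE adj_sym.
apply: leq_trans (subset_leq_card sub) _.
apply: (@leq_trans (\sum_(u in N) d.+1)); last first.
  by rewrite sum_nat_const leq_mul2r degree_le_max orbT.
apply: leq_trans (card_bigcup_le _ _) _; apply: leq_sum => u _.
by rewrite cardsU1 -add1n leq_add ?leq_b1 ?parents_le.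
Qed.

Lemma related_coloring (K : nat) : (max_degree G * d.+1 < K)%N ->
  exists h : G -> 'I_K, forall x y, related x y -> h x != h y.
Proof.
move=> K_gt; have [x|h hP] := @greedy_coloring G related pos K.
  apply: leq_ltn_trans K_gt; apply: leq_trans (card_related x).
  by apply/subset_leq_card/subsetP=> y; rewrite !inE => /andP[].
(* As [related] is symmetric and [pos] injective, each related pair is constrained at its later
   vertex. *)
exists h => x y rxy; have /andP[neq _] := rxy.
have [|lt|/pos_inj eq] := ltngtP (pos x) (pos y).
- rewrite eq_sym => lt; apply: hP lt; move: rxy.
  rewrite /related eq_sym adj_sym.
  by under eq_existsb do rewrite andbC.
- exact: hP.
- by rewrite eq eqxx in neq.
Qed.

Lemma edge_orientation (e : edge G) :
  exists p : G * G, val e = [set p.1; p.2] /\ p.2 \in parents p.1.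
Proof.
case/imsetP: (valP e) => -[u v]; rewrite inE /= => uv def_e.
have [lt|lt|/pos_inj eq] := ltngtP (pos u) (pos v).
- by exists (v, u); rewrite setUC inE adj_sym uv.
- by exists (u, v); rewrite inE uv.
- by rewrite eq adj_irrefl in uv.
Qed.

Lemma inj_chromatic_index_parents (K m t : nat) :
  (max_degree G * d.+1 < K)%N -> (0 < m)%N -> (4 * d <= m)%N ->
  (K ^ (2 * d).+1 < 2 ^ t)%N ->
  (inj_chromatic_index G <= t * m * (2 * d).+1)%N.
Proof.
move=> K_gt m_gt0 dm Kt; have [h hP] := related_coloring K_gt.
have [|||F FP] := @cover_free 'I_K m (2 * d) t; rewrite ?card_ord // ?mulnA //.
have [ends endsP] := fin_all_exists edge_orientation.
pose tl e := (ends e).1; pose hd e := (ends e).2.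
have val_e e : val e = [set tl e; hd e] by case: (endsP e).
have hd_par e : hd e \in parents (tl e) by case: (endsP e).
have hd_lt e : (pos (hd e) < pos (tl e))%N by have := hd_par e; rewrite inE => /andP[].
(* These vertices must not own the point chosen for [e]. All are related to [hd e], by the common
   child [tl e] or by adjacency, so their labels differ from its label. *)
pose near e := (parents (tl e) :\ hd e) :|: parents (hd e).
have near_le e : (#|near e| <= 2 * d)%N.
  rewrite mul2n -addnn (leq_trans (leq_card_setU _ _)) // leq_add ?parents_le //.
  by rewrite (leq_trans _ (parents_le (tl e))) // subset_leq_card ?subsetDl.
have near_h e w : w \in near e -> h (hd e) != h w.
  rewrite !inE => /orP[/andP[neq w_par]|/andP[hw lt]]; apply: hP.
    rewrite /related eq_sym neq; apply/orP; right; apply/existsP; exists (tl e).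
    by rewrite hd_par inE.
  by rewrite /related hw andbT; apply: contraTneq lt => ->; rewrite ltnn.
have /fin_all_exists[j jP] e : exists j,
    forall w, w \in near e -> F j (h w) != F j (h (hd e)).
  have [||j jP] := FP (h (hd e)) (h @: near e).
  - by apply/imsetP=> -[w /near_h/eqP].
  - exact: leq_trans (leq_imset_card _ _) (near_le e).
  - by exists j => w w_near; apply/jP/imset_f.
pose point e := (j e, F (j e) (h (hd e))).
have point_near e e' : point e = point e' -> hd e' \notin near e.
  by case=> eqj eqF; apply/negP=> /jP; rewrite {1}eqj -eqF eqxx.
have tl_inj e e' : point e = point e' -> tl e = tl e' -> e = e'.
  move=> eq_pt eq_tl; apply: val_inj; rewrite !val_e eq_tl.
  have := point_near _ _ eq_pt; rewrite in_setU in_setD1 eq_tl hd_par andbT.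
  by rewrite negb_or negbK => /andP[/eqP->].
(* By [tl_inj], edges with the point of [e] have distinct tails, so [e] clashes with at most [2 * d]
   of them. *)
pose clash e e' :=
  (tl e' \in parents (tl e) :|: parents (hd e)) && (point e == point e').
have [e|c cP] := @greedy_coloring _ clash (pos \o tl) (2 * d).+1.
  rewrite ltnS; apply: (@leq_trans #|parents (tl e) :|: parents (hd e)|); last first.
    by rewrite mul2n -addnn (leq_trans (leq_card_setU _ _)) // leq_add ?parents_le.
  rewrite -(@card_in_imset _ _ tl); last first.
    move=> e1 e2; rewrite !inE => /andP[/andP[_ /eqP eq1] _] /andP[/andP[_ /eqP eq2] _].
    by apply: tl_inj; rewrite -eq1.
  apply/subset_leq_card/subsetP=> _ /imsetP[e' + ->].
  by rewrite inE => /andP[/andP[]].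
have no_join e e' (g : edge G) x y : point e = point e' -> c e = c e' ->
    g != e -> x \in val e -> y \in val e' -> val g = [set x; y] -> ~ (pos y < pos x)%N.
  move=> eq_pt eq_c neq_ge; rewrite (val_e e) (val_e e') => + + def_g lt.
  have y_par : y \in parents x by rewrite inE lt (edge_adj def_g).
  rewrite !inE => /orP[]/eqP def_x /orP[]/eqP def_y.
  (* If [y] is the tail of [e'], then [e] clashes with [e'], whose tail is earlier, and [c] differs.
     If [y] is its head, then [y] is not near [e], which leaves only [x = tl e] and [y = hd e], that
     is [g = e]. *)
  - suff /eqP : c e != c e' by [].
    by apply: cP; rewrite /= -?def_x -?def_y // /clash eq_pt eqxx inE -def_x -def_y y_par.
  - have := point_near _ _ eq_pt; rewrite inE negb_or -def_y => /andP[+ _].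
    rewrite in_setD1 -def_x y_par andbT negbK => /eqP def_y'.
    by case/eqP: neq_ge; apply: val_inj; rewrite (val_e e) def_g -def_x -def_y'.
  - suff /eqP : c e != c e' by [].
    apply: cP; last by rewrite /= -def_y (ltn_trans lt) // def_x.
    by rewrite /clash eq_pt eqxx inE -def_x -def_y y_par orbT.
  - by have := point_near _ _ eq_pt; rewrite inE -def_x -def_y y_par orbT.
have -> : (t * m * (2 * d).+1 = #|{: 'I_t * 'I_m * 'I_(2 * d).+1}|)%N.
  by rewrite !card_prod !card_ord.
apply: (inj_chromatic_index_le (psi := fun e => (point e, c e))).
move=> e e' _ [eq_pt1 eq_pt2 eq_c] g ge ge'.
have eq_pt : point e = point e' by rewrite /point eq_pt2 eq_pt1.
apply/negP=> /existsP[x /andP[xe /existsP[y /andP[ye' /eqP def_g]]]].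
have [lt|lt|/pos_inj eq_xy] := ltngtP (pos x) (pos y).
- by apply: (no_join e' e g y x) lt; rewrite // setUC.
- exact: (no_join e e' g x y) lt.
- by have := edge_adj def_g; rewrite eq_xy adj_irrefl.
Qed.

End Coloring.

(** * Choice of parameters and the final bound *)

Lemma inj_chromatic_index_degenerate (d l : nat) (G : sgraph) :
  (1 <= d)%N -> (2 <= max_degree G)%N -> (max_degree G <= 2 ^ l)%N ->
  degenerate d G -> (inj_chromatic_index G <= 120 * l * d ^ 3)%N.
Proof.
move=> d_gt0 D_ge2 D_le /degenerate_minn /degenerate_order[pos pos_inj].
have : (0 < minn d (max_degree G))%N by rewrite leq_min d_gt0 ltnW.
move: (minn _ _) (geq_minl d (max_degree G)) (geq_minr d (max_degree G)).
move=> d' le_d le_D d'_gt0 parents_le.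
have l_gt0 : (0 < l)%N by case: l D_le => //; rewrite expn0 leqNgt D_ge2.
(* With D the maximum degree, D(D+1) < D^3 <= 2^(3l) makes 2^(3l) labels enough; [t] is then the
   least exponent with K^(2d'+1) < 2^t. *)
apply: leq_trans (@inj_chromatic_index_parents G d' pos pos_inj parents_le
  (2 ^ (3 * l)) (4 * d') (3 * l * (2 * d').+1).+1 _ _ _ _) _ => //.
- have D_lt : (max_degree G * (max_degree G).+1 < max_degree G ^ 3)%N by nia.
  apply: (@leq_ltn_trans (max_degree G * (max_degree G).+1)).
    by rewrite leq_mul2l ltnS le_D orbT.
  by apply: leq_trans D_lt _; rewrite mulnC expnM leq_exp2r.
- by rewrite muln_gt0.
- by rewrite -expnM ltn_exp2l.
(* Since [l] and [d'] are positive, 2d'+1 <= 3d' and 3l(2d'+1)+1 <= 10ld'. *)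
apply: (@leq_trans (10 * l * d' * (4 * d') * (3 * d'))).
  by rewrite !leq_mul //; nia.
have -> : (10 * l * d' * (4 * d') * (3 * d') = 120 * l * d' ^ 3)%N by lia.
by rewrite leq_mul2l leq_exp2r ?le_d ?orbT.
Qed.

Theorem theorem1p4 (R : realType) :
  exists2 C : R, 0 < C &
    forall (d Delta : nat) (G : sgraph),
      (1 <= d)%N -> (2 <= Delta)%N ->
      degenerate d G -> max_degree G = Delta ->
      (inj_chromatic_index G)%:R <= C * d%:R ^+ 3 * ln (Delta%:R : R).
Proof.
have ln2_gt0 : 0 < ln 2 :> R by rewrite ln_gt0 // ltr1n.
(* Here 240 is twice 120: rounding the binary logarithm of [Delta] up at most doubles it, as [Delta]
   is at least 2. *)
exists (240 / ln 2); first by rewrite divr_gt0.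
move=> d Delta G d_gt0 D_ge2 deg def_D.
pose l := up_log 2 Delta.
have D_gt0 : (0 < Delta)%N by apply: leq_trans D_ge2.
have l_le : l%:R * ln 2 <= 2 * ln (Delta%:R : R).
  have /andP[lo _] : (2 ^ l.-1 < Delta <= 2 ^ l)%N by apply: up_log_bounds.
  have ln_pred : l.-1%:R * ln 2 <= ln (Delta%:R : R).
    rewrite mulr_natl -lnXn // -natrX ler_ln ?posrE ?ltr0n ?expn_gt0 //.
    by rewrite ler_nat ltnW.
  have ln_2 : ln 2 <= ln (Delta%:R : R) by rewrite ler_ln ?posrE ?ltr0n ?ler_nat.
  have l_gt0 : (0 < l)%N by rewrite up_log_gt0.
  by rewrite -(prednK l_gt0) -natr1; lra.
have := @inj_chromatic_index_degenerate d l G.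
rewrite def_D up_logP // => /(_ d_gt0 D_ge2 isT deg).
rewrite -(ler_nat R) => /le_trans; apply.
rewrite natrM natrX natrM.
have -> : 240 / ln 2 * d%:R ^+ 3 * ln (Delta%:R : R) =
    120 * (2 * ln (Delta%:R : R) / ln 2) * d%:R ^+ 3.
  by field; rewrite gt_eqF.
by rewrite ler_wpM2r ?exprn_ge0 // ler_wpM2l // ler_pdivlMr.
Qed.
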